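(* Let $H$ be a graph, let $r\ge 1$ and $t>1$ be integers, and assume that $K_r$ is not contained in $H$. Then there exists $n_0$ (depending on $H,r,t$) such that for every $n\ge n_0$ there exists an $n$-vertex $tK_r$-free graph that contains exactly $\mathrm{ex}(n,H,tK_r)$ copies of $H$ and that contains $t-1$ vertices of degree $n-1$.
   Context: All graphs are finite and simple with at least one vertex. $K_r$ is the complete graph on $r$ vertices and $tK_r$ is the vertex-disjoint union of $t$ copies of $K_r$. A graph is $F$-free if it has no (not necessarily induced) subgraph isomorphic to $F$; ''$K_r$ is not contained in $H$'' means $H$ is $K_r$-free. A copy of $H$ in $G$ is a (not necessarily induced) subgraph of $G$ isomorphic to $H$. $\mathrm{ex}(n,H,F)$ is the largest number of copies of $H$ in an $F$-free $n$-vertex graph. *)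

(* Defs.v *)
From HB Require Import structures.
From mathcomp Require Import all_boot.
Set Implicit Arguments.
Unset Strict Implicit.
Unset Printing Implicit Defensive.

(* The vertex set is the whole type T. *)
Record sgraph (T : finType) := SGraph {
  edges : {set {set T}};
  edges_card2 : [forall e in edges, #|e| == 2]
}.

HB.instance Definition _ (T : finType) := [isSub for @edges T].
HB.instance Definition _ (T : finType) := [Finite of sgraph T by <:].

Section Defs.
Variables U V : finType.

Definition degree (G : sgraph V) (v : V) : nat :=
  #|[set w | [set v; w] \in edges G]|.

(* (S.1, S.2) = (vertex set, edge set) of a subgraph, not necessarily induced. *)
Definition is_subgraph (S : {set V} * {set {set V}}) (G : sgraph V) : bool :=
  (S.2 \subset edges G) && [forall e in S.2, e \subset S.1].

Definition iso_to (H : sgraph U) (S : {set V} * {set {set V}}) : bool :=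
  [exists f : {ffun U -> V},
    [&& injectiveb f, [set f x | x : U] == S.1
      & [set f @: (e : {set U}) | e in edges H] == S.2]].

Definition copies (H : sgraph U) (G : sgraph V) :
    {set {set V} * {set {set V}}} :=
  [set S | is_subgraph S G && iso_to H S].

Definition graph_free (F : sgraph U) (G : sgraph V) : bool := copies F G == set0.

End Defs.

Lemma complete_card2 (r : nat) :
  [forall e in [set e : {set 'I_r} | #|e| == 2], #|e| == 2].
Proof. by apply/forall_inP => e; rewrite inE. Qed.

Definition complete (r : nat) : sgraph 'I_r := SGraph (complete_card2 r).

(* The vertex (i, x) of t K_r is the vertex x of the i-th copy of K_r. *)
Definition tcomplete_edges (t r : nat) : {set {set 'I_t * 'I_r}} :=
  [set e : {set 'I_t * 'I_r} |
     (#|e| == 2) && [forall x in e, [forall y in e, x.1 == y.1]]].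

Lemma tcomplete_card2 (t r : nat) :
  [forall e in tcomplete_edges t r, #|e| == 2].
Proof. by apply/forall_inP => e; rewrite inE => /andP[]. Qed.

Definition tcomplete (t r : nat) : sgraph ('I_t * 'I_r)%type :=
  SGraph (tcomplete_card2 t r).

Definition ex (n : nat) (U W : finType) (H : sgraph U) (F : sgraph W) : nat :=
  \max_(G : sgraph 'I_n | graph_free F G) #|copies H G|.

(* Main.v *)
(** Let [G] be an extremal graph, and let [A] be the set of vertices [v] for
    which no set of at most [t * r] vertices meets every [K_r] through [v]
    outside [v].
    Vertices of [A] can be put into disjoint copies of [K_r] greedily, so
    [|A| <= t - 1], and if equality holds then [G - A] is [K_r]-free. Otherwise a
    maximal packing of copies of [K_r] in [G - A], together with a small hitting
    set for each of its vertices, gives a set [C] of bounded size such that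
    every [K_r] of [G - A] has an edge inside [C]. Delete the edges inside [C] and
    make [t - 1] vertices, including [A], universal: the result is
    [t K_r]-free. At most [O(n^(h-2))] copies of [H] are lost, where [h = |H|].
    As [H] is [K_r]-free, a balanced blow-up of [H] shows that [G] has
    [Omega(n^h)] copies of [H]; since [G] has no clique of size [t * r], some
    vertex [v] is non-adjacent to the image of a given vertex of [H] in a positive
    proportion of the embeddings, and making [v] universal creates
    [Omega(n^(h-1))] new copies. *)

Require Import Defs.
From mathcomp Require Import all_boot zify.

Set Implicit Arguments.
Unset Strict Implicit.
Unset Printing Implicit Defensive.

(** * Counting bounds for finite sets and functions *)

Lemma card_fibre_le (T T' : finType) (A : {set T}) (g : T -> T') (m : nat) :
  (forall y, #|[set x in A | g x == y]| <= m) -> #|A| <= #|g @: A| * m.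
Proof.
move=> le_m; rewrite -sum1_card (partition_big_imset g) /= -sum_nat_const.
apply: leq_sum => y _; rewrite sum1dep_card.
by apply: leq_trans (le_m y); rewrite subset_leq_card //; apply/subsetP => x; rewrite !inE.
Qed.

Lemma card_bigcup_le (I T : finType) (P : pred I) (F : I -> {set T}) :
  #|\bigcup_(i | P i) F i| <= \sum_(i | P i) #|F i|.
Proof.
elim/big_rec2: _ => [|i m X _ IH]; first by rewrite cards0.
by apply: leq_trans (leq_card_setU _ _) _; rewrite leq_add2l.
Qed.

Lemma card_ffun_into (U V : finType) (X : {set U}) (C : {set V}) :
  #|[set f : {ffun U -> V} | [forall x in X, f x \in C]]|
    = #|C| ^ #|X| * #|V| ^ (#|U| - #|X|).
Proof.
pose F x := [pred y | (x \in X) ==> (y \in C)].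
have -> : #|[set f : {ffun U -> V} | [forall x in X, f x \in C]]| = #|family F|.
  apply: eq_card => f; rewrite inE; apply/forall_inP/familyP => fC x.
    by rewrite inE; apply/implyP/fC.
  by move=> xX; have := fC x; rewrite inE xX.
rewrite card_family foldrE big_map big_enum /= (bigID (mem X)) /=.
rewrite (eq_bigr (fun=> #|C|)) => [|x xX]; last first.
  by apply: eq_card => y; rewrite unfold_in xX.
rewrite prod_nat_const (eq_bigr (fun=> #|V|)) => [|x /negPf xX]; last first.
  by apply: eq_card => y; rewrite unfold_in xX.
rewrite prod_nat_const; congr (_ * _ ^ _).
by rewrite -(cardC X) addKn; apply: eq_card => x; rewrite !inE.
Qed.

(** * Adjacency, graphs built from relations, and cliques *)

Section Adjacency.
Variable V : finType.
Implicit Types (G : sgraph V) (R : rel V).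

Definition adj G : rel V := fun x y => [set x; y] \in edges G.

Lemma edge_card2 G e : e \in edges G -> #|e| = 2.
Proof. by move=> eG; have /forall_inP/(_ e eG)/eqP := edges_card2 G. Qed.

Lemma adj_sym G : symmetric (adj G).
Proof. by move=> x y; rewrite /adj setUC. Qed.

Lemma adj_neq G x y : adj G x y -> x != y.
Proof. by move=> /edge_card2; rewrite cards2; case: (x != y). Qed.

Lemma edgeP G e :
  reflect (exists x y, adj G x y /\ e = [set x; y]) (e \in edges G).
Proof.
apply: (iffP idP) => [eG | [x [y [xy ->]]] //].
have /eqP/cards2P[x [y [_ def_e]]] := edge_card2 eG.
by exists x, y; rewrite /adj -def_e.
Qed.

Lemma rel_edges_card2 R :
  [forall e in [set e : {set V} | (#|e| == 2) &&
     [forall x in e, forall y in e, (x != y) ==> R x y]], #|e| == 2].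
Proof. by apply/forall_inP => e; rewrite inE => /andP[]. Qed.

Definition rel_graph R : sgraph V := SGraph (rel_edges_card2 R).

Lemma adj_rel_graph R x y : adj (rel_graph R) x y = [&& x != y, R x y & R y x].
Proof.
rewrite /adj inE cards2; case: (eqVneq x y) => //= neq_xy.
apply/forall_inP/andP => [Rxy | [Rxy Ryx] a].
  split.
    by have /forall_inP/(_ y (set22 _ _)) := Rxy x (set21 _ _); rewrite neq_xy.
  have /forall_inP/(_ x (set21 _ _)) := Rxy y (set22 _ _).
  by rewrite eq_sym neq_xy.
rewrite !inE => a_xy; apply/forall_inP => b; rewrite !inE => b_xy.
apply/implyP; case/orP: a_xy => /eqP->; case/orP: b_xy => /eqP-> //;
  by rewrite eqxx.
Qed.

Definition is_clique G (Q : {set V}) : bool :=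
  [forall x in Q, forall y in Q, (x != y) ==> adj G x y].

Lemma cliqueP G (Q : {set V}) :
  reflect {in Q &, forall x y, x != y -> adj G x y} (is_clique G Q).
Proof.
apply: (iffP forall_inP) => [cQ x y xQ yQ | cQ x xQ].
  by apply/implyP; apply: (forall_inP (cQ x xQ)).
by apply/forall_inP => y yQ; apply/implyP; apply: cQ.
Qed.

Definition rclique G (r : nat) : pred {set V} :=
  fun Q => is_clique G Q && (#|Q| == r).

End Adjacency.

(** * Embeddings and the copies they determine *)

Section Embeddings.
Variables U V : finType.
Implicit Types (H : sgraph U) (G : sgraph V) (f : {ffun U -> V}).

(** Labelled copies of [H]. Copies are the images of embeddings under [copy_of], so they can be
    counted through maps, up to the fibres bounded in [card_copy_of_fibre]. *)
Definition emb H G : {set {ffun U -> V}} :=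
  [set f : {ffun U -> V} | injectiveb f
    & [forall e in edges H, f @: (e : {set U}) \in edges G]].

Definition copy_of H f : {set V} * {set {set V}} :=
  (f @: setT, [set f @: (e : {set U}) | e in edges H]).

Lemma imset_setT f : f @: setT = [set f x | x : U].
Proof. by apply/setP => y; apply/imsetP/imsetP => -[x _ ->]; exists x. Qed.

Lemma embP H G f :
  reflect (injective f /\ forall x y, adj H x y -> adj G (f x) (f y))
    (f \in emb H G).
Proof.
rewrite inE; apply: (iffP andP) => [[/injectiveP f_inj /forall_inP fH] | [f_inj fH]].
  split=> // x y /fH; rewrite /adj imsetU1 imset_set1; exact.
split; first exact/injectiveP.
by apply/forall_inP => e /edgeP[x [y [/fH xy ->]]]; rewrite imsetU1 imset_set1.
Qed.

Lemma copiesE H G : copies H G = copy_of H @: emb H G.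
Proof.
apply/setP => S; apply/idP/imsetP => [|[f]].
  rewrite inE => /andP[/andP[SG _] /existsP[f /and3P[f_inj /eqP S1 /eqP S2]]].
  exists f; last first.
    by rewrite /copy_of S2 imset_setT S1; case: S {SG S1 S2}.
  rewrite inE f_inj; apply/forall_inP => e eH.
  by apply: (subsetP SG); rewrite -S2 imset_f.
rewrite inE => /andP[f_inj /forall_inP fH] ->; rewrite inE; apply/andP; split.
  apply/andP; split=> /=; first by apply/subsetP => _ /imsetP[e eH ->]; apply: fH.
  by apply/forall_inP => _ /imsetP[e eH ->]; apply: imsetS; apply/subsetP => x; rewrite inE.
apply/existsP; exists f; rewrite f_inj eqxx andbT /=.
by rewrite imset_setT.
Qed.

Lemma graph_freeE H G : graph_free H G = (emb H G == set0).
Proof. by rewrite /graph_free copiesE imset_eq0. Qed.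

(** Every map in the fibre has image [S.1], which by injectivity has [#|U|] vertices; the fibre thus
    lies among the maps from [U] to [S.1]. *)
Lemma card_copy_of_fibre H S (B : {set {ffun U -> V}}) :
  (forall f, f \in B -> injective f) ->
  #|[set f in B | copy_of H f == S]| <= #|U| ^ #|U|.
Proof.
move=> B_inj; have [-> | [f0]] := set_0Vmem [set f in B | copy_of H f == S].
  by rewrite cards0.
rewrite inE => /andP[/B_inj f0_inj /eqP S_f0].
have cardS : #|S.1| = #|U| by rewrite -S_f0 /= card_imset // cardsT.
rewrite -{1}cardS -card_ffun_on subset_leq_card //.
apply/subsetP => f; rewrite inE => /andP[_ /eqP fS].
by apply/ffun_onP => x; rewrite -fS /= imset_f // inE.
Qed.

End Embeddings.

(** * Clique packings and hitting sets *)

Lemma adj_complete r x y : adj (complete r) x y = (x != y).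
Proof. by rewrite /adj inE cards2; case: (x != y). Qed.

Lemma adj_tcomplete t r x y :
  adj (tcomplete t r) x y = (x != y) && (x.1 == y.1).
Proof.
rewrite /adj inE cards2; case: (eqVneq x y) => //= neq_xy.
apply/forall_inP/eqP => [xy | xy a].
  by have /forall_inP/(_ y (set22 _ _))/eqP := xy x (set21 _ _).
rewrite !inE => a_xy; apply/forall_inP => b; rewrite !inE => b_xy.
by case/orP: a_xy => /eqP->; case/orP: b_xy => /eqP->; rewrite ?eqxx ?xy.
Qed.

Section Cliques.
Variable V : finType.
Implicit Types (G : sgraph V) (A B C Q Z : {set V}) (s : seq {set V}).

Lemma rclique_complete G r Q : rclique G r Q -> ~~ graph_free (complete r) G.
Proof.
case/andP=> /cliqueP cQ /eqP cardQ; rewrite graph_freeE; apply/set0Pn.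
exists [ffun i => enum_val (cast_ord (esym cardQ) i)]; apply/embP; split.
  by move=> i j; rewrite !ffunE => /enum_val_inj/cast_ord_inj.
move=> i j; rewrite adj_complete !ffunE => neq_ij; apply: cQ; rewrite ?enum_valP //.
by apply: contra neq_ij => /eqP/enum_val_inj/cast_ord_inj->.
Qed.

Lemma big_clique_tcomplete G t r Q :
  is_clique G Q -> #|Q| = t * r -> ~~ graph_free (tcomplete t r) G.
Proof.
move=> /cliqueP cQ cardQ; rewrite graph_freeE; apply/set0Pn.
have eqQ : #|{: 'I_t * 'I_r}| = #|Q| by rewrite card_prod !card_ord.
exists [ffun p => enum_val (cast_ord eqQ (enum_rank p))].
have f_inj : injective (fun p => enum_val (cast_ord eqQ (enum_rank p))).
  by move=> p q /enum_val_inj/cast_ord_inj/enum_rank_inj.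
apply/embP; split=> [p q | p q]; rewrite ?adj_tcomplete !ffunE; first exact: f_inj.
case/andP=> neq_pq _; apply: cQ; rewrite ?enum_valP //.
by apply: contra neq_pq => /eqP/f_inj->.
Qed.

Definition packing G r s : bool :=
  all (rclique G r) s && pairwise (fun Q Q' => [disjoint Q & Q']) s.

Lemma packing_tcomplete G t r s :
  packing G r s -> size s = t -> ~~ graph_free (tcomplete t r) G.
Proof.
move=> /andP[/all_nthP s_cl /(pairwiseP set0) s_dis] sz_s.
have s_i (i : 'I_t) : rclique G r (nth set0 s i) by apply: s_cl; rewrite sz_s.
have card_i i : r = #|nth set0 s (i : 'I_t)| by have /andP[_ /eqP] := s_i i.
pose f (p : 'I_t * 'I_r) := enum_val (cast_ord (card_i p.1) p.2).
have fP p : f p \in nth set0 s p.1 by apply: enum_valP.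
have f_inj : injective f.
  move=> [i x] [j y] eq_f; have [eq_ij | neq_ij] := eqVneq i j.
    by move: eq_f; rewrite eq_ij => /enum_val_inj/cast_ord_inj /= ->.
  wlog lt_ij: i j x y eq_f neq_ij / i < j.
    move=> wl; case: (ltngtP i j) => [|lt_ji|/val_inj eq_ij]; first exact: wl.
      by apply/esym; apply: wl lt_ji; rewrite // eq_sym.
    by rewrite eq_ij eqxx in neq_ij.
  have dis_ij : [disjoint nth set0 s i & nth set0 s j].
    by apply: s_dis lt_ij; rewrite inE sz_s ltn_ord.
  by have := disjointFr dis_ij (fP (i, x)); rewrite eq_f fP.
rewrite graph_freeE; apply/set0Pn; exists (finfun f); apply/embP; split=> [p q|p q].
  by rewrite !ffunE; apply: f_inj.
rewrite adj_tcomplete !ffunE => /andP[neq_pq /eqP eq_pq].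
have /andP[/cliqueP cQ _] := s_i p.1.
apply: cQ; first exact: fP; first by rewrite eq_pq; apply: fP.
by apply: contra neq_pq => /eqP/f_inj->.
Qed.

(** A copy of [t K_r] would consist of [t] disjoint cliques, each with a vertex of its own in
    [A]. *)
Lemma tcomplete_free_of_hitting G t r A :
  #|A| < t -> (forall Q, rclique G r Q -> ~~ [disjoint Q & A]) ->
  graph_free (tcomplete t r) G.
Proof.
move=> ltAt hitA; rewrite graph_freeE; apply/negPn/negP => /set0Pn[f /embP[f_inj fG]].
pose Q i := [set f (i, x) | x : 'I_r].
have QA i : exists x, f (i, x) \in A.
  have /pred0Pn[_ /andP[/imsetP[x _ ->] xA]] : ~~ [disjoint Q i & A]; last by exists x.
  apply: hitA; apply/andP; split.
    apply/cliqueP=> _ _ /imsetP[x _ ->] /imsetP[y _ ->] neq_xy.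
    by apply: fG; rewrite adj_tcomplete eqxx andbT; apply: contra neq_xy => /eqP->.
  by rewrite card_imset ?card_ord // => x y /f_inj[].
pose g i := f (i, xchoose (QA i)).
have g_inj : injective g by move=> i j /f_inj[].
have: #|[set g i | i : 'I_t]| <= #|A|.
  by apply/subset_leq_card/subsetP => _ /imsetP[i _ ->]; apply: xchooseP (QA i).
by rewrite card_imset // card_ord leqNgt ltAt.
Qed.

Lemma disjoint_bigcup_seq Q s :
  [disjoint Q & \bigcup_(X <- s) X] = all (fun X : {set V} => [disjoint Q & X]) s.
Proof.
elim: s => [|X s IH] /=; first by rewrite big_nil -setI_eq0 setI0 eqxx.
by rewrite big_cons -IH -!setI_eq0 setIUr setU_eq0.
Qed.

Lemma packing_cons G r Q s :
  packing G r s -> rclique G r Q -> [disjoint Q & \bigcup_(X <- s) X] ->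
  packing G r (Q :: s).
Proof.
by move=> /andP[s_cl s_dis] Q_cl Qs; rewrite /packing /= Q_cl s_cl -disjoint_bigcup_seq Qs.
Qed.

Lemma card_packing G r s :
  packing G r s -> #|\bigcup_(X <- s) X| <= size s * r.
Proof.
case/andP=> s_cl _; elim: s s_cl => [|X s IH] /=; first by rewrite big_nil cards0.
case/andP=> /andP[_ /eqP cardX] /IH; rewrite big_cons mulSn => IHs.
by apply: leq_trans (leq_card_setU _ _) _; rewrite cardX leq_add2l.
Qed.

Definition pins G r v Z : bool :=
  [forall Q, rclique G r Q && (v \in Q) ==> ~~ [disjoint Q :\ v & Z]].

Definition unpinned G r k : {set V} :=
  [set v | ~~ [exists Z : {set V}, (#|Z| <= k) && pins G r v Z]].

Lemma unpinned_clique G r k v Z :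
  v \in unpinned G r k -> #|Z| <= k ->
  exists Q, [/\ rclique G r Q, v \in Q & [disjoint Q :\ v & Z]].
Proof.
rewrite inE negb_exists => /forallP/(_ Z); case: leqP => //= _ + _.
by rewrite negb_forall => /existsP[Q]; rewrite negb_imply negbK => /andP[/andP[]]; exists Q.
Qed.

(** Greedy choice: each vertex of [A] in turn receives a clique through it that avoids the current
    packing and the vertices of [A] still waiting. *)
Lemma extend_packing G r k A s : 0 < r ->
  packing G r s -> A \subset unpinned G r k -> [disjoint A & \bigcup_(X <- s) X] ->
  (size s + #|A|) * r <= k ->
  exists2 s', packing G r s' & size s' = size s + #|A|.
Proof.
move=> r_gt0; move: {2}#|A| (erefl #|A|) => m.
elim: m A s => [|m IH] A s cardA pack_s sAu As le_k.
  by exists s; rewrite ?cardA ?addn0.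
have [a aA] : exists a, a \in A by apply/card_gt0P; rewrite cardA.
have cardA1 : #|A :\ a| = m by have := cardsD1 a A; rewrite aA cardA => -[].
have [|Q [Q_cl aQ]] := unpinned_clique (subsetP sAu a aA)
    (Z := \bigcup_(X <- s) X :|: A :\ a).
  (* The set to avoid has at most [size s * r + (#|A| - 1)] vertices, within the budget [k] since
     [r > 0]. *)
  apply: leq_trans (leq_card_setU _ _) _; apply: leq_trans le_k.
  rewrite cardA1 cardA mulnDl; apply: leq_add; first exact: card_packing pack_s.
  by rewrite (leq_trans (leqnSn m)) // leq_pmulr.
rewrite -setI_eq0 setIUr setU_eq0 !setI_eq0 => /andP[Qs QA].
(* Being unpinned only controls [Q :\ a]; the vertex [a] itself misses the packing because [A]
   does. *)
have Qs' : [disjoint Q & \bigcup_(X <- s) X].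
  rewrite -(setD1K aQ) disjoint_subset; apply/subsetP => x; rewrite inE => /orP[|xQ].
    by rewrite inE => /eqP->; rewrite inE (disjointFr As aA).
  by rewrite inE (disjointFr Qs xQ).
have pack' := packing_cons pack_s Q_cl Qs'.
have [|||s' s'P s'sz] := IH (A :\ a) (Q :: s) cardA1 pack'.
- exact: subset_trans (subsetDl _ _) sAu.
- rewrite big_cons disjoint_sym -setI_eq0 setIUl setU_eq0 !setI_eq0; apply/andP; split.
    rewrite disjoint_sym disjoint_subset; apply/subsetP => x xA.
    have := disjointFl QA xA; rewrite !inE; move: xA; rewrite !inE => /andP[-> _] /=.
    by move=> ->.
  by rewrite disjoint_sym (disjointWl (subsetDl _ _) As).
- by rewrite /= cardA1 addSnnS -cardA.
by exists s'; rewrite // s'sz /= cardA1 cardA addSnnS.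
Qed.

(** Keep adding cliques that avoid [A]: either [m] of them are found, or the process stops and the
    union of the packing meets every further clique avoiding [A]. *)
Lemma packing_or_hitting G r A m :
  (exists2 s : seq {set V}, packing G r s & size s = m) \/
  (exists2 B : {set V}, #|B| <= m * r &
     forall Q : {set V}, rclique G r Q -> [disjoint Q & A] -> ~~ [disjoint Q & B]).
Proof.
suff: (exists2 s : seq {set V}, packing G r s & size s = m) \/
  exists2 s : seq {set V}, packing G r s & size s <= m /\
     forall Q : {set V}, rclique G r Q -> [disjoint Q & A] ->
       ~~ [disjoint Q & \bigcup_(X <- s) X].
  case=> [|[s pack_s [sz_s hit_s]]]; first by left.
  right; exists (\bigcup_(X <- s) X) => //; apply: leq_trans (card_packing pack_s) _.
  by rewrite leq_mul2r sz_s orbT.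
elim: m => [|m [[s pack_s sz_s]|[s pack_s [sz_s hit_s]]]].
- by left; exists [::].
- have [/forallP hit_s|/forallPn[Q]] := boolP
      [forall Q : {set V}, rclique G r Q ==> [disjoint Q & A] ==>
        ~~ [disjoint Q & \bigcup_(X <- s) X]].
    right; exists s => //; split; first by rewrite sz_s.
    by move=> Q Q_cl QA; have := hit_s Q; rewrite Q_cl QA.
  rewrite 2!negb_imply negbK => /and3P[Q_cl _ Qs].
  by left; exists (Q :: s); [exact: packing_cons | rewrite /= sz_s].
by right; exists s => //; split=> //; apply: leqW.
Qed.

(** Deleting the edges inside [C] destroys every [K_r] that avoids [A]. When [#|A| = t - 1] there is
    no room for another universal vertex to make up for losses, so there [C] must be empty. *)
Lemma clique_structure G t r : 0 < t -> 0 < r -> graph_free (tcomplete t r) G ->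
  exists A C, [/\ #|A| < t, #|C| <= t * r * (t * r).+1, #|A|.+1 = t -> C = set0
    & forall Q, rclique G r Q -> [disjoint Q & A] -> 1 < #|Q :&: C|].
Proof.
move=> t_gt0 r_gt0 freeG; pose A := unpinned G r (t * r).
have no_pack s : packing G r s -> size s = t -> False.
  by move=> /packing_tcomplete tc /tc; rewrite freeG.
have ltAt : #|A| < t.
  (* Otherwise [t] vertices of [A] extend the empty packing to [t] disjoint cliques. *)
  rewrite ltnNge; apply/negP => /card_geqP[p [p_uniq sz_p pA]].
  have [|||||s] := @extend_packing G r (t * r) [set x in p] [::].
  - by [].
  - by [].
  - by apply/subsetP => x; rewrite inE => /pA.
  - by rewrite big_nil -setI_eq0 setI0.
  - by rewrite cardsE (card_uniqP p_uniq) sz_p.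
  by move=> /no_pack + sz_s; apply; rewrite sz_s /= cardsE (card_uniqP p_uniq).
have [eqAt|neqAt] := eqVneq #|A|.+1 t.
  (* A clique avoiding [A], extended by one clique for each of the [t - 1] vertices of [A], would
     give [t] disjoint cliques; the last condition is therefore vacuous. *)
  exists A, set0; split; rewrite ?cards0 // => Q Q_cl QA.
  have [|||s] := @extend_packing G r (t * r) A [:: Q] r_gt0 _ (subxx _).
  - by rewrite packing_cons // big_nil -setI_eq0 setI0.
  - by rewrite big_seq1 disjoint_sym.
  - by rewrite /= add1n eqAt.
  by move=> /no_pack + sz_s; case; rewrite sz_s.
have [[s /no_pack no_s /no_s []] | [B cardB hitB]] := packing_or_hitting G r A t.
(* A pinning set for each vertex outside [A]. The default [set0] serves vertices without one, and
   keeps the size bound valid for all [v]. *)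
pose Cv v := odflt set0 [pick Z : {set V} | (#|Z| <= t * r) && pins G r v Z].
have cardCv v : #|Cv v| <= t * r.
  by rewrite /Cv; case: pickP => [Z /andP[]|] //=; rewrite cards0.
have CvP v : v \notin A -> pins G r v (Cv v).
  rewrite inE negbK /Cv => /existsP[Z ZP].
  by case: pickP => [Z' /andP[]|/(_ Z)] //=; rewrite ZP.
exists A, (B :|: \bigcup_(v in B) Cv v); split => //.
- apply: leq_trans (leq_card_setU _ _) _; rewrite mulnS leq_add //.
  apply: leq_trans (card_bigcup_le _ _) _.
  apply: (@leq_trans (\sum_(v in B) t * r)); first exact: leq_sum.
  by rewrite sum_nat_const leq_mul2r cardB orbT.
- by move=> eqAt; rewrite eqAt eqxx in neqAt.
(* The two vertices in [C] are some [b] of [Q] in [B] and a second vertex of [Q] in the pinning set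
   of [b]. *)
move=> Q Q_cl QA; have /pred0Pn[b /andP[/= bQ bB]] := hitB Q Q_cl QA.
have /CvP/forallP/(_ Q) : b \notin A by rewrite (disjointFr QA bQ).
rewrite Q_cl bQ /= => /pred0Pn[c /andP[/= /setD1P[neq_cb cQ] cC]].
apply/card_gt1P; exists b, c; rewrite eq_sym neq_cb !inE bQ cQ bB /=; split=> //.
by apply/orP; right; apply/bigcupP; exists b.
Qed.

End Cliques.

(** * Adding universal vertices and deleting the edges inside a set *)

Lemma subset_extend (T : finType) (A : {set T}) (m : nat) :
  #|A| <= m <= #|T| -> exists2 B : {set T}, A \subset B & #|B| = m.
Proof.
case/andP=> le_Am le_mT.
have /card_geqP[s [s_uniq sz_s sA]] : m - #|A| <= #|~: A|.
  by rewrite -(leq_add2l #|A|) cardsC subnKC.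
exists (A :|: [set x in s]); first exact: subsetUl.
rewrite cardsU disjoint_setI0 ?cards0 ?subn0.
  by rewrite cardsE (card_uniqP s_uniq) sz_s subnKC.
by rewrite disjoint_sym disjoint_subset; apply/subsetP => x; rewrite inE => /sA; rewrite inE.
Qed.

Section Join.
Variable V : finType.
Implicit Types (G : sgraph V) (A C Q : {set V}).

(** Edges inside [C] that touch [A] survive, so [A] stays universal. With [C := set0] the
    construction only adds edges, which separates gains from losses. *)
Definition join_graph G A C : sgraph V :=
  rel_graph (fun x y =>
    [|| x \in A, y \in A | adj G x y && ~~ ((x \in C) && (y \in C))]).

Lemma adj_join G A C x y : adj (join_graph G A C) x y =
  (x != y) && [|| x \in A, y \in A | adj G x y && ~~ ((x \in C) && (y \in C))].
Proof.
rewrite adj_rel_graph (adj_sym G y x) (andbC (y \in C)) (orbCA (y \in A)).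
by rewrite andbb.
Qed.

(** The set [A] meets every [K_r] of the new graph: a clique avoiding [A] is already one of [G]
    avoiding [A0], hence has two vertices in [C], whose edge was deleted. *)
Lemma join_graph_free G t r A0 A C :
  #|A| < t -> A0 \subset A ->
  (forall Q, rclique G r Q -> [disjoint Q & A0] -> 1 < #|Q :&: C|) ->
  graph_free (tcomplete t r) (join_graph G A C).
Proof.
move=> ltAt sA0A C_two; apply: (tcomplete_free_of_hitting ltAt) => Q Q_cl.
apply/negP => QA; have /andP[/cliqueP cQ cardQ] := Q_cl.
have joinQ : {in Q &, forall x y, x != y -> adj G x y && ~~ ((x \in C) && (y \in C))}.
  move=> x y xQ yQ neq_xy; have := cQ x y xQ yQ neq_xy.
  by rewrite adj_join neq_xy (disjointFr QA xQ) (disjointFr QA yQ).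
have /card_gt1P[x [y [+ + neq_xy]]] : 1 < #|Q :&: C|.
  apply: C_two (disjointWr sA0A QA); rewrite /rclique cardQ andbT.
  by apply/cliqueP => x y xQ yQ /(joinQ x y xQ yQ)/andP[].
rewrite !inE => /andP[xQ xC] /andP[yQ yC].
by have := joinQ x y xQ yQ neq_xy; rewrite xC yC andbF.
Qed.

Lemma degree_join G A C v : v \in A -> degree (join_graph G A C) v = #|V| - 1.
Proof.
move=> vA; rewrite /degree subn1 -(cardsC1 v); apply: eq_card => w.
by rewrite inE -/(adj _ v w) adj_join vA andbT !inE eq_sym.
Qed.

End Join.

(** * Copies lost by deletion and gained from a universal vertex *)

Section Counting.
Variables U V : finType.
Implicit Types (H : sgraph U) (G : sgraph V) (A C : {set V}).

Lemma copies_subset H G G' :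
  (forall x y, adj G x y -> adj G' x y) -> copies H G \subset copies H G'.
Proof.
move=> sGG'; rewrite !copiesE; apply: imsetS; apply/subsetP => f /embP[f_inj fG].
by apply/embP; split=> // x y /fG/sGG'.
Qed.

Lemma card_copies_le H G : #|copies H G| <= #|emb H G|.
Proof. by rewrite copiesE leq_imset_card. Qed.

(** A lost copy sends both ends of some edge of [H] into [C]: this leaves [#|C| ^ 2] choices for
    these ends and [#|V|] for each other vertex. *)
Lemma card_copies_join H G A C :
  #|copies H (join_graph G A set0)| <= #|copies H (join_graph G A C)|
    + #|[set p | adj H p.1 p.2]| * (#|C| ^ 2 * #|V| ^ (#|U| - 2)).
Proof.
pose F (p : U * U) := [set f : {ffun U -> V} | [forall x in [set p.1; p.2], f x \in C]].
pose lost := \bigcup_(p in [set p | adj H p.1 p.2]) F p.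
have: copies H (join_graph G A set0) \subset
    copies H (join_graph G A C) :|: copy_of H @: lost.
  rewrite (copiesE _ (join_graph G A set0)); apply/subsetP => _ /imsetP[f /embP[f_inj fG] ->].
  rewrite inE; have [f_lost|f_kept] := boolP (f \in lost).
    by rewrite imset_f ?orbT.
  rewrite copiesE imset_f //; apply/embP; split=> // x y xy.
  have := fG x y xy; rewrite !adj_join !inE andbT.
  case/andP=> -> /or3P[-> //|->|->]; rewrite ?orbT //=.
  suff -> : ~~ ((f x \in C) && (f y \in C)) by rewrite !orbT.
  apply: contra f_kept => /andP[fxC fyC]; apply/bigcupP; exists (x, y); first by rewrite inE.
  by rewrite inE; apply/forall_inP => z; rewrite !inE => /orP[] /eqP->.
move/subset_leq_card/leq_trans; apply.
apply: leq_trans (leq_card_setU _ _) _; rewrite leq_add2l.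
apply: leq_trans (leq_imset_card _ _) _; apply: leq_trans (card_bigcup_le _ _) _.
rewrite -sum_nat_const; apply: leq_sum => -[x y]; rewrite inE /= => /adj_neq neq_xy.
by rewrite card_ffun_into cards2 neq_xy.
Qed.

Lemma card_emb_through (B : {set {ffun U -> V}}) v :
  #|[set f in B | [exists x, f x == v]]| <= #|U| * #|V| ^ (#|U| - 1).
Proof.
pose F x := [set f : {ffun U -> V} | [forall y in [set x], f y \in [set v]]].
have: [set f in B | [exists x, f x == v]] \subset \bigcup_x F x.
  apply/subsetP => f; rewrite inE => /andP[_ /existsP[x fx]].
  apply/bigcupP; exists x => //; rewrite inE.
  by apply/forall_inP => y; rewrite !inE => /eqP->.
move/subset_leq_card/leq_trans; apply; apply: leq_trans (card_bigcup_le _ _) _.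
rewrite -sum_nat_const; apply: leq_sum => x _.
by rewrite card_ffun_into !cards1 exp1n mul1n.
Qed.

(* Moving the image of [u'] to the universal vertex [v] turns an embedding
   missing [v] into a copy using the new edge from [v] to the image of [u]. *)
Lemma card_new_copies H G A u u' v : adj H u u' -> v \in A ->
  #|[set f in emb H G | ~~ adj G v (f u)]| <= #|U| * #|V| ^ (#|U| - 1) +
    #|copies H (join_graph G A set0) :\: copies H G| * #|U| ^ #|U| * #|V|.
Proof.
move=> uu' vA; set L := [set f in emb H G | _].
pose thru := [set f : {ffun U -> V} | [exists x, f x == v]].
rewrite -(cardsID thru L); apply: leq_add.
  have -> : L :&: thru = [set f in L | [exists x, f x == v]].
    by apply/setP => f; rewrite !inE.
  exact: card_emb_through.
set L' := L :\: thru.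
have L'P f : f \in L' -> [/\ f \in emb H G, ~~ adj G v (f u) & forall x, f x != v].
  by rewrite in_setD !inE negb_exists => /andP[/forallP fv /andP[fG fu]].
pose move_u' (f : {ffun U -> V}) := [ffun x => if x == u' then v else f x].
have neq_uu' : u == u' = false by apply: negbTE (adj_neq uu').
have moveP f : f \in L' -> move_u' f \in emb H (join_graph G A set0).
  move=> /L'P[/embP[f_inj fG] _ fv].
  have inj' : injective (move_u' f).
    move=> x y; rewrite !ffunE; case: eqP => [->|_]; case: eqP => [->|_] //.
    - by move=> /esym/eqP; rewrite (negbTE (fv y)).
    - by move=> /eqP; rewrite (negbTE (fv x)).
    - exact: f_inj.
  apply/embP; split=> // x y xy.
  rewrite adj_join (inj_eq inj') (adj_neq xy) !inE andbT !ffunE /=.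
  case: eqP => [_|_]; first by rewrite vA.
  case: eqP => [_|_]; first by rewrite vA orbT.
  by rewrite fG ?orbT.
(* An embedding [f] is recovered from [move_u' f] and the old image [f u']. *)
have fibre g : #|[set f in L' | move_u' f == g]| <= #|V|.
  rewrite -(@card_in_imset _ _ (fun f : {ffun U -> V} => f u')) ?max_card //.
  move=> f1 f2; rewrite inE => /andP[_ /eqP f1g]; rewrite inE => /andP[_ /eqP f2g] eq_u'.
  apply/ffunP => x; have [->//|neq_xu'] := eqVneq x u'.
  by have /ffunP/(_ x) := etrans f1g (esym f2g); rewrite !ffunE (negbTE neq_xu').
apply: leq_trans (card_fibre_le fibre) _; rewrite leq_mul2r; apply/orP; right.
have fibre2 S : #|[set f in move_u' @: L' | copy_of H f == S]| <= #|U| ^ #|U|.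
  apply: card_copy_of_fibre => _ /imsetP[f /moveP/embP[f_inj _] ->] //.
apply: leq_trans (card_fibre_le fibre2) _; rewrite leq_mul2r; apply/orP; right.
apply/subset_leq_card/subsetP => _ /imsetP[_ /imsetP[f fL' ->] ->].
(* The moved copy is new because it uses the edge from [v] to [f u], absent from [G]. *)
rewrite in_setD andbC copiesE imset_f ?moveP //=.
apply/negP; rewrite inE => /andP[/andP[/subsetP edG _] _].
have [_ /negP nadj _] := L'P f fL'; apply: nadj; rewrite adj_sym; apply: edG.
apply/imsetP; exists [set u; u']; first exact: uu'.
by rewrite imsetU1 imset_set1 !ffunE neq_uu' eqxx.
Qed.

(* Otherwise a clique of size [t * r] could be grown greedily: the few
   embeddings that send [u] outside the common neighbourhood of the current
   clique do not exhaust all embeddings. *)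
Lemma exists_many_nonneighbours H G t r u :
  graph_free (tcomplete t r) G -> 0 < #|emb H G| ->
  exists v, #|emb H G| <= t * r * #|[set f in emb H G | ~~ adj G v (f u)]|.
Proof.
move=> freeG E_gt0; pose L v := [set f in emb H G | ~~ adj G v (f u)].
have [/existsP[v vP]|/existsPn few] := boolP [exists v, #|emb H G| <= t * r * #|L v|].
  by exists v.
suff [Q cQ cardQ] : exists2 Q : {set V}, is_clique G Q & #|Q| = t * r.
  by have := big_clique_tcomplete cQ cardQ; rewrite freeG.
suff grow j : j <= t * r -> exists2 Q : {set V}, is_clique G Q & #|Q| = j by exact: grow.
elim: j => [_|j IH lt_j].
  by exists set0; rewrite ?cards0 //; apply/cliqueP => x y; rewrite inE.
have [Q /cliqueP cQ cardQ] := IH (ltnW lt_j).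
have [f fE f_good] : exists2 f, f \in emb H G & f \notin \bigcup_(x in Q) L x.
  apply/subsetPn; apply/negP => /subset_leq_card; apply/negP; rewrite -ltnNge.
  apply: leq_ltn_trans (card_bigcup_le _ _) _.
  (* Scaling by [t * r] avoids division: each of the [j < t * r] sets [L x] has less than a
     [1 / (t * r)] share of the embeddings. *)
  rewrite -(@ltn_pmul2l (t * r)) ?(leq_ltn_trans _ lt_j) // big_distrr /=.
  apply: (@leq_ltn_trans (\sum_(x in Q) #|emb H G|)).
    by apply: leq_sum => x _; apply/ltnW; rewrite ltnNge few.
  by rewrite sum_nat_const cardQ ltn_pmul2r.
have f_adj x : x \in Q -> adj G x (f u).
  move=> xQ; apply: contraR f_good => nadj; apply/bigcupP; exists x => //.
  by rewrite inE fE.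
exists (f u |: Q); last first.
  rewrite cardsU1 cardQ; case: (boolP (f u \in Q)) => // /f_adj/adj_neq.
  by rewrite eqxx.
apply/cliqueP => x y; rewrite !inE => /orP[/eqP->|xQ] /orP[/eqP->|yQ].
- by rewrite eqxx.
- by move=> _; rewrite adj_sym f_adj.
- by move=> _; rewrite f_adj.
- exact: cQ.
Qed.

(** * Blow-ups and the lower bound on the extremal number *)

Definition blowup H (g : V -> U) : sgraph V :=
  rel_graph (fun x y => adj H (g x) (g y)).

Lemma adj_blowup H (g : V -> U) x y : adj (blowup H g) x y = adj H (g x) (g y).
Proof.
rewrite adj_rel_graph adj_sym andbb; case: eqVneq => // ->.
by apply/esym/negP => /adj_neq; rewrite eqxx.
Qed.

(** Vertices with the same image under [g] are non-adjacent, so a [K_r] would project injectively to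
    a [K_r] of [H]. As there is none, the empty set hits every [K_r]. *)
Lemma blowup_free H (g : V -> U) t r :
  0 < t -> graph_free (complete r) H -> graph_free (tcomplete t r) (blowup H g).
Proof.
move=> t_gt0 freeH; apply: (@tcomplete_free_of_hitting _ _ _ _ set0); rewrite ?cards0 //.
move=> Q /andP[/cliqueP cQ /eqP cardQ]; have := freeH.
have g_inj : {in Q &, injective g}.
  move=> x y xQ yQ eq_g; apply/eqP; apply: contraT => /(cQ x y xQ yQ).
  by rewrite adj_blowup eq_g => /adj_neq; rewrite eqxx.
apply: contraTT => _; apply: (@rclique_complete _ _ _ (g @: Q)).
rewrite /rclique card_in_imset // cardQ eqxx andbT.
apply/cliqueP => _ _ /imsetP[x xQ ->] /imsetP[y yQ ->] neq_g.
by rewrite -adj_blowup cQ //; apply: contra neq_g => /eqP->.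
Qed.

(** Only sections of [g] are counted: two sections with the same image coincide, so they yield
    distinct copies without division by automorphisms. *)
Lemma card_copies_blowup H (g : V -> U) q :
  (forall u, q <= #|[set x | g x == u]|) ->
  q ^ #|U| <= #|copies H (blowup H g)|.
Proof.
move=> le_q; pose S := [set f : {ffun U -> V} | [forall u, g (f u) == u]].
have SP f : f \in S -> cancel f g by rewrite inE => /forallP fK u; apply/eqP.
apply: (@leq_trans #|copy_of H @: S|); last first.
  rewrite copiesE; apply/subset_leq_card/imsetS/subsetP => f /SP fK.
  by apply/embP; split=> [|x y]; [exact: can_inj fK | rewrite adj_blowup !fK].
rewrite card_in_imset => [|f1 f2 /SP f1K /SP f2K [/setP eq_im _]]; last first.
  apply/ffunP => u; have := eq_im (f1 u); rewrite imset_f ?inE //.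
  by move=> /esym/imsetP[u2 _ eq_f]; rewrite -[u in RHS]f1K eq_f f2K.
have -> : #|S| = #|family (fun u => [pred x | g x == u])|.
  apply: eq_card => f; rewrite inE; apply/forallP/familyP => fS u;
  by have := fS u; rewrite inE.
rewrite card_family foldrE big_map big_enum /= -prod_nat_const.
apply: leq_prod => u _; apply: leq_trans (le_q u) _.
by apply/subset_leq_card/subsetP => x; rewrite !inE.
Qed.

End Counting.

Lemma blowup_bound (U : finType) (H : sgraph U) (n t r : nat) :
  0 < #|U| -> 0 < t -> graph_free (complete r) H ->
  exists2 G : sgraph 'I_n, graph_free (tcomplete t r) G
    & (n %/ #|U|) ^ #|U| <= #|copies H G|.
Proof.
move=> U_gt0 t_gt0 freeH.
(* Classes are residues modulo [#|U|]; each contains the numbers [j * #|U| + enum_rank u] with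
   [j < n %/ #|U|]. *)
pose g (i : 'I_n) : U := enum_val (Ordinal (ltn_pmod i U_gt0)).
exists (blowup H g); first exact: blowup_free.
apply: card_copies_blowup => u.
have lt_n (j : 'I_(n %/ #|U|)) : j * #|U| + enum_rank u < n.
  apply: (@leq_trans (j.+1 * #|U|)); first by rewrite mulSn addnC ltn_add2r.
  by apply: leq_trans (leq_divM n #|U|); rewrite leq_mul2r ltn_ord orbT.
pose h j := Ordinal (lt_n j).
have h_inj : injective h.
  move=> i j [] /addIn /eqP; rewrite eqn_pmul2r // => /eqP; exact: val_inj.
rewrite -{1}[n %/ #|U|]card_ord -(card_imset predT h_inj).
apply/subset_leq_card/subsetP => _ /imsetP[j _ ->]; rewrite inE.
apply/eqP; rewrite -[u in RHS]enum_rankK; congr enum_val; apply: val_inj.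
by rewrite /= modnMDl modn_small.
Qed.

(** * Choice of the universal vertices and comparison of orders of magnitude *)

Theorem proposition1p5 (U : finType) (H : sgraph U) (r t : nat)
    (hU : 0 < #|U|) (hr : 1 <= r) (ht : 1 < t) (hH : graph_free (complete r) H) :
  exists n0 : nat, forall n : nat, n0 <= n ->
    exists G : sgraph 'I_n,
      [/\ graph_free (tcomplete t r) G,
          #|copies H G| = ex n H (tcomplete t r)
        & t - 1 <= #|[set v : 'I_n | degree G v == n - 1]|].
Proof.
(* [K] bounds [#|C|], and [D] comes from [n <= 2 * h * (n %/ h)]. In [M], the term [h] pays for
   embeddings through [v], the other for lost copies times the fibre size [h ^ h]. *)
pose h := #|U|; pose k := t * r; pose K := k * k.+1; pose D := (2 * h) ^ h.
pose M := h + h ^ 2 * K ^ 2 * h ^ h.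
(* The summands ensure [0 < n %/ h], room for [t - 1] vertices, and the final contradiction with
   [n <= D * k * M]. *)
exists (h + t + (D * k * M).+1) => n le_n.
have t_gt0 : 0 < t by apply: ltnW.
have [B freeB cardB] := blowup_bound n hU t_gt0 hH.
have [G freeG exG] : exists2 G : sgraph 'I_n, graph_free (tcomplete t r) G &
    ex n H (tcomplete t r) = #|copies H G|.
  have [|G freeG exG] := @eq_bigmax_cond _
      [pred G : sgraph 'I_n | graph_free (tcomplete t r) G] (fun G => #|copies H G|); first by apply/card_gt0P; exists B.
  by exists G.
have exP (G' : sgraph 'I_n) : graph_free (tcomplete t r) G' -> #|copies H G'| <= #|copies H G|.
  by rewrite -exG; exact: (leq_bigmax_cond (F := fun G => #|copies H G|)).
have [A [C [ltAt leC C0 C_two]]] := clique_structure t_gt0 hr freeG.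
suff [A' [sAA' cardA' le_copies]] : exists A' : {set 'I_n},
    [/\ A \subset A', #|A'| = t - 1 & #|copies H G| <= #|copies H (join_graph G A' C)|].
  have freeG' : graph_free (tcomplete t r) (join_graph G A' C).
    by apply: join_graph_free sAA' C_two; rewrite cardA'; lia.
  exists (join_graph G A' C); split=> //.
    by apply/eqP; rewrite eqn_leq exG le_copies exP.
  rewrite -cardA'; apply/subset_leq_card/subsetP => v vA'.
  by rewrite inE degree_join // card_ord.
have copies_G1 A' : copies H G \subset copies H (join_graph G A' set0).
  by apply: copies_subset => x y xy; rewrite adj_join xy (adj_neq xy) !inE !orbT.
set P := [set p | adj H p.1 p.2].
have lost A' : #|copies H (join_graph G A' set0)| <=
    #|copies H (join_graph G A' C)| + #|P| * (#|C| ^ 2 * n ^ (h - 2)).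
  by have := card_copies_join H G A' C; rewrite card_ord.
(* If [C] is empty or [H] has no edge, nothing is lost and any superset of [A] of size [t - 1]
   works. *)
have [no_loss|] := boolP ((C == set0) || (P == set0)).
  have [|A' sAA' cardA'] := @subset_extend _ A (t - 1).
    by rewrite card_ord; apply/andP; split; lia.
  exists A'; split=> //; apply: leq_trans (subset_leq_card (copies_G1 A')) _.
  by apply: leq_trans (lost A') _; case/orP: no_loss => /eqP->;
    rewrite cards0 !(mul0n, muln0, addn0).
rewrite negb_or => /andP[C_neq0 /set0Pn[[u u']]]; rewrite inE /= => uu'.
have h_gt1 : 1 < h.
  by rewrite /h -cardsT; apply/card_gt1P; exists u, u'; rewrite !inE (adj_neq uu').
have n_gt0 : 0 < n by lia.
have le_nE : n ^ h <= D * #|emb H G|.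
  apply: (@leq_trans (D * #|copies H G|)); last by rewrite leq_mul2l card_copies_le orbT.
  apply: (@leq_trans (D * (n %/ h) ^ h)).
    rewrite /D -expnMn leq_exp2r ?(ltnW h_gt1) //.
    have := divn_eq n h; have := ltn_pmod n (ltnW h_gt1).
    have: 0 < n %/ h by rewrite divn_gt0 ?(ltnW h_gt1) //; lia.
    by nia.
  by rewrite leq_mul2l (leq_trans cardB) ?orbT // exP.
have [|v vP] := exists_many_nonneighbours u freeG (H := H).
  by case: posnP le_nE => // ->; rewrite muln0 leqn0 expn_eq0 (gtn_eqF n_gt0).
(* Since [C] is nonempty, [#|A| < t - 1], which leaves room for [v]. *)
have [|A' sAA' cardA'] := @subset_extend _ (v |: A) (t - 1).
  have neqAt : #|A|.+1 != t by apply: contra C_neq0 => /eqP/C0->.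
  by rewrite cardsU1 card_ord; apply/andP; split; lia.
exists A'; split=> //; first exact: subset_trans (subsetUr _ _) sAA'.
have vA' : v \in A' by apply: (subsetP sAA'); rewrite !inE eqxx.
rewrite leqNgt; apply/negP => lt_copies.
have := card_new_copies G uu' vA'; rewrite card_ord -/h.
set N := #|_ :\: _|; set L := #|[set f in _ | _]| in vP * => leL.
have leP : #|P| <= h ^ 2.
  by apply: leq_trans (max_card _) _; rewrite card_prod.
(* If the new graph had fewer copies than [G], the gain [N] could not exceed the loss, which is of
   order [n ^ (h - 2)]. *)
have leN : N <= h ^ 2 * K ^ 2 * n ^ (h - 2).
  have := lost A'; rewrite -(cardsID (copies H G)) (setIidPr (copies_G1 A')) -/N.
  have : #|P| * (#|C| ^ 2 * n ^ (h - 2)) <= h ^ 2 * K ^ 2 * n ^ (h - 2).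
    by rewrite mulnA leq_mul // leq_mul // leq_exp2r.
  move=> le_lost le_copies1; rewrite -(leq_add2l #|copies H G|).
  by apply: leq_trans le_copies1 (leq_add (ltnW lt_copies) le_lost).
have leLM : L <= M * n ^ (h - 1).
  apply: leq_trans leL _; rewrite /M mulnDl leq_add2l.
  have -> : n ^ (h - 1) = n ^ (h - 2) * n by rewrite -expnSr; congr (n ^ _); lia.
  rewrite mulnA leq_mul2r; apply/orP; right.
  by rewrite mulnAC leq_mul2r leN orbT.
(* With so small a gain, the embeddings missing adjacency to [v] number only [O(n^(h-1))], although
   they form a [1 / k] share of at least [n ^ h / D] embeddings. *)
have : n ^ h <= D * k * M * n ^ (h - 1).
  apply: leq_trans le_nE _; rewrite -!mulnA leq_mul2l; apply/orP; right.
  by apply: leq_trans vP _; rewrite mulnA leq_mul2l leLM orbT.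
have -> : n ^ h = n * n ^ (h - 1) by rewrite -expnS; congr (n ^ _); lia.
by rewrite leq_pmul2r ?expn_gt0 ?n_gt0 // leqNgt; lia.
Qed.
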